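(* Let $n,m\in\mathbb{N}$, and let $A,X,f$ satisfy: (a) $A\in\{0,1\}^{n\times m}$ has no zero column; (b) $\{\mathbf{0}_m,\mathbf{e}_1,\dots,\mathbf{e}_m\}\subseteq X\subseteq\mathbb{R}^m_+$; (c) $f:X\to\mathbb{R}$ satisfies $f(\mathbf{0}_m)=0$ and $f(x)\le\sum_{j=1}^m f(\mathbf{e}_j)x_j$ for all $x\in X$. Let $F(x)=\sum_{j=1}^m f(\mathbf{e}_j)x_j$ for $x\in\mathbb{R}^m_+$, let $\overline{X}=\{x\in X: f(x)=F(x)\}$, and for $w\in\{0,1\}^n$ define $$\nu_{X,f}(w)=\max_{x\in X}[f(x):Ax\le w],\quad \nu_{\overline{X},F}(w)=\max_{x\in\overline{X}}[F(x):Ax\le w],\quad \nu_{\mathbb{R}^m_+,F}(w)=\max_{x\in\mathbb{R}^m_+}[F(x):Ax\le w].$$ Then $\mathrm{core}(\nu_{X,f})$ is non-empty if and only if $\nu_{\overline{X},F}(\mathbf{1}_n)=\nu_{\mathbb{R}^m_+,F}(\mathbf{1}_n)$.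
   Context: Notation: $\mathbf{0}_n,\mathbf{1}_n$ are the all-zero and all-one vectors in $\mathbb{R}^n$; $\mathbf{e}_j$ is the $j$-th unit vector; $\mathbb{R}^m_+$ is the set of componentwise non-negative vectors; vector inequalities are componentwise. Standing convention: the maxima defining the games are attained for every $w\in\{0,1\}^n$. The core of a (revenue) game $\nu:\{0,1\}^n\to\mathbb{R}$ is $\mathrm{core}(\nu)=\{y\in\mathbb{R}^n:\mathbf{1}_n^Ty=\nu(\mathbf{1}_n),\ a^Ty\ge\nu(a)\ \forall a\in\{0,1\}^n\}$. *)

(* Defs.v *)
From mathcomp Require Import all_boot all_order all_algebra.
From mathcomp Require Import all_classical all_reals.

Set Implicit Arguments.
Unset Strict Implicit.
Unset Printing Implicit Defensive.

Import Order.TTheory GRing.Theory Num.Theory.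
Local Open Scope classical_set_scope.
Local Open Scope ring_scope.

Definition zero_one (R : realType) (p q : nat) (M : 'M[R]_(p, q)) : Prop :=
  forall i j, M i j = 0 \/ M i j = 1.

Definition le_cv (R : realType) (p : nat) (u v : 'cV[R]_p) : Prop :=
  forall i, u i 0 <= v i 0.

Definition orthant (R : realType) (m : nat) : set 'cV[R]_m :=
  [set x | le_cv 0 x].
Arguments orthant : clear implicits.

Definition unit_cv (R : realType) (m : nat) (j : 'I_m) : 'cV[R]_m :=
  delta_mx j 0.

Definition ones (R : realType) (n : nat) : 'cV[R]_n := const_mx 1.

Definition dot (R : realType) (n : nat) (u v : 'cV[R]_n) : R :=
  (u^T *m v) 0 0.

Definition feasible (R : realType) (n m : nat) (A : 'M[R]_(n, m))
    (X : set 'cV[R]_m) (w : 'cV[R]_n) : set 'cV[R]_m :=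
  [set x | X x /\ le_cv (A *m x) w].

Definition max_attained (R : realType) (n m : nat) (A : 'M[R]_(n, m))
    (X : set 'cV[R]_m) (g : 'cV[R]_m -> R) : Prop :=
  forall w : 'cV[R]_n, zero_one w ->
    exists2 x, feasible A X w x & forall z, feasible A X w z -> g z <= g x.

(* A game on {0,1}^n is a function on 'cV[R]_n of which only the values at 0/1
   vectors matter. The supremum is the maximum at every such vector as soon as
   [max_attained A X g] holds. *)
Definition game (R : realType) (n m : nat) (A : 'M[R]_(n, m))
    (X : set 'cV[R]_m) (g : 'cV[R]_m -> R) (w : 'cV[R]_n) : R :=
  sup [set g x | x in feasible A X w].

Definition core (R : realType) (n : nat) (nu : 'cV[R]_n -> R) :
    set 'cV[R]_n :=
  [set y | dot (ones R n) y = nu (ones R n) /\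
           forall a, zero_one a -> nu a <= dot a y].

Definition lin_ext (R : realType) (m : nat) (f : 'cV[R]_m -> R)
    (x : 'cV[R]_m) : R :=
  \sum_(j < m) f (unit_cv R j) * x j 0.

Definition agree_set (R : realType) (m : nat) (X : set 'cV[R]_m)
    (f : 'cV[R]_m -> R) : set 'cV[R]_m :=
  [set x | X x /\ f x = lin_ext f x].

(* Main.v *)
Require Import Defs.
From mathcomp Require Import all_boot all_order all_algebra.
From mathcomp Require Import all_classical all_reals.

Set Implicit Arguments.
Unset Strict Implicit.
Unset Printing Implicit Defensive.

Import Order.TTheory GRing.Theory Num.Theory.
Local Open Scope classical_set_scope.
Local Open Scope ring_scope.

(** Write c for the vector of the values f(e_j), so that F(x) = c^T x, and
consider the linear program of maximising c^T x over x >= 0, A x <= 1, with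
optimal value V. Its dual asks for y >= 0 with A^T y >= c minimising 1^T y.

If y is in the core of the game of (X, f), then y is dual feasible: testing the
core inequality on the singletons e_i, where x = 0 is feasible, gives y >= 0
([core_ge0]), and testing it on the columns A e_j, where x = e_j is feasible,
gives A^T y >= c ([core_dual_feasible]). By weak duality V <= 1^T y = f(x) for
any maximiser x of f over X and A x <= 1; since f(x) <= F(x) <= V, equality holds throughout, so x
lies in the set where f and F agree and attains V there.

Conversely, if V is attained on the set where f and F agree, then V is also the
maximum of f over X at the all-one vector. An optimal dual solution y, provided
by [lp_strong_duality], is then in the core: its total is V, and if A x <= a
with x in X, then f(x) <= c^T x <= y^T A x <= y^T a.

Strong duality is derived from Farkas' lemma ([farkas]), which holds over any
ordered field and is proved here by induction on the number of inequalities. *)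

Lemma dotE (R : realType) (n : nat) (u v : 'cV[R]_n) :
  dot u v = \sum_i u i 0 * v i 0.
Proof. by rewrite /dot mxE; apply: eq_bigr => i _; rewrite mxE. Qed.

Lemma dotC (R : realType) (n : nat) (u v : 'cV[R]_n) : dot u v = dot v u.
Proof. by rewrite !dotE; apply: eq_bigr => i _; rewrite mulrC. Qed.

Lemma ler_dot (R : realType) (n : nat) (y u v : 'cV[R]_n) :
  le_cv 0 y -> le_cv u v -> dot y u <= dot y v.
Proof.
move=> y0 uv; rewrite !dotE; apply: ler_sum => i _.
by apply: ler_wpM2l; [have := y0 i; rewrite mxE | exact: uv].
Qed.

Lemma dot_trmul (R : realType) (n m : nat) (A : 'M[R]_(n, m)) y x :
  dot (A^T *m y) x = dot y (A *m x).
Proof. by rewrite /dot trmx_mul trmxK mulmxA. Qed.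

(** Farkas' lemma. In the inductive step with first row a, either the remaining
rows already imply c x <= 0, or some x0 satisfies them with c x0 > 0, so that
a x0 > 0. In the second case the rows and c are composed with the projection P
onto the hyperplane a x = 0 along x0, which makes the first row redundant. *)
Lemma farkas (R : realType) (p q : nat) (M : 'M[R]_(p, q)) (c : 'rV[R]_q) :
  (forall x : 'cV[R]_q, le_cv (M *m x) 0 -> (c *m x) 0 0 <= 0) ->
  exists2 l : 'rV[R]_p, (forall i, 0 <= l 0 i) & c = l *m M.
Proof.
elim: p M c => [|p IH] M c hc.
  (* With no inequality at all, the hypothesis at x = c^T forces c = 0. *)
  exists 0 => [[]//|]; rewrite mul0mx.
  have := hc c^T; have -> : (c *m c^T) 0 0 = \sum_j c 0 j ^+ 2.
    by rewrite mxE; apply: eq_bigr => j _; rewrite mxE expr2.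
  move=> /(_ ltac:(by case)) le0.
  have ge0 : forall j, true -> 0 <= c 0 j ^+ 2 by move=> j _; exact: sqr_ge0.
  have /eqP : \sum_j c 0 j ^+ 2 = 0.
    by apply/eqP; rewrite eq_le le0 sumr_ge0.
  rewrite psumr_eq0 // => /allP h; apply/rowP => j; rewrite mxE.
  by have := h j (mem_index_enum _); rewrite /= sqrf_eq0 => /eqP.
pose a : 'rV[R]_q := usubmx (M : 'M_(1 + p, q)).
pose N : 'M[R]_(p, q) := dsubmx (M : 'M_(1 + p, q)).
have MaN : M = col_mx a N :> 'M_(1 + p, q) by rewrite vsubmxK.
have leM x : (a *m x) 0 0 <= 0 -> le_cv (N *m x) 0 -> le_cv (M *m x) 0.
  move=> ha hN i; rewrite MaN (mul_col_mx a) [X in X <= _]mxE [X in _ <= X]mxE.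
  by case: splitP => [k _|k _]; [rewrite ord1 | have := hN k; rewrite [X in _ <= X]mxE].
have [hN|/existsNP [x0 /not_implyP [Nx0 /negP]]] :=
    pselect (forall x : 'cV[R]_q, le_cv (N *m x) 0 -> (c *m x) 0 0 <= 0).
  have [l l0 cE] := IH N c hN.
  exists (row_mx (0 : 'rV_1) l : 'rV_(1 + p)).
    by move=> i; rewrite mxE; case: splitP => k _; rewrite ?mxE.
  by rewrite MaN (mul_row_col (0 : 'rV_1)) mul0mx add0r.
rewrite -ltNge => cx0.
have ax0 : 0 < (a *m x0) 0 0.
  by rewrite ltNge; apply/negP => /leM/(_ Nx0)/hc; rewrite leNgt cx0.
set s := (a *m x0) 0 0 in ax0.
have s0 : s != 0 by rewrite gt_eqF.
pose P : 'M[R]_q := 1%:M - s^-1 *: (x0 *m a).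
have aP0 : a *m P = 0.
  rewrite mulmxBr mulmx1 -scalemxAr mulmxA [a *m x0]mx11_scalar -/s.
  by rewrite mul_scalar_mx scalerA mulVf // scale1r subrr.
have [x hx|l l0 cE] := IH (N *m P) (c *m P).
  rewrite -mulmxA; apply: hc; apply: leM; last by rewrite mulmxA.
  by rewrite mulmxA aP0 mul0mx mxE.
(* The multiplier of a is (c x0 - l N x0) / (a x0), nonnegative because
   c x0 > 0 and N x0 <= 0. *)
exists (row_mx ((s^-1 * ((c *m x0) 0 0 - (l *m N *m x0) 0 0))%:M : 'rV_1) l
          : 'rV_(1 + p)).
  move=> i; rewrite mxE; case: splitP => k _ //.
  rewrite ord1 mxE eqxx mulr1n mulr_ge0 ?invr_ge0 ?ltW //.
  rewrite subr_gt0 (le_lt_trans _ cx0) // -mulmxA mxE.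
  apply: sumr_le0 => j _; rewrite mulr_ge0_le0 //.
  by have := Nx0 j; rewrite [X in _ <= X]mxE.
rewrite MaN (mul_row_col (_%:M : 'rV_1)) mul_scalar_mx.
move: cE; rewrite mulmxA !mulmxBr !mulmx1 -!scalemxAr !mulmxA.
rewrite [c *m x0]mx11_scalar [l *m N *m x0]mx11_scalar !mul_scalar_mx.
set u := (c *m x0) 0 0; set v := (l *m N *m x0) 0 0.
rewrite !scalerA => /eqP; rewrite subr_eq => /eqP ->.
rewrite [u%:M 0 0]mxE [v%:M 0 0]mxE !mulr1n mulrBr scalerBl.
by rewrite addrAC [RHS]addrC [RHS]addrA.
Qed.

(** Strong duality for max c^T x subject to x >= 0, A x <= w, given a primal
optimum x. Farkas' lemma is applied to the homogenised system
A u <= t w, u >= 0, t >= 0 in the unknowns (u, t), which implies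
c^T u <= (c^T x) t. *)
Lemma lp_strong_duality (R : realType) (n m : nat) (A : 'M[R]_(n, m))
    (c : 'cV[R]_m) (w : 'cV[R]_n) (x : 'cV[R]_m) :
  feasible A (orthant R m) w x ->
  (forall z, feasible A (orthant R m) w z -> dot c z <= dot c x) ->
  exists y, [/\ le_cv 0 y, le_cv c (A^T *m y) & dot w y = dot c x].
Proof.
move=> [x0 Axw] xmax.
pose M : 'M[R]_(n + (m + 1), m + 1) := col_mx (row_mx A (- w)) (- 1%:M).
have [z hz|l l0] := @farkas R _ _ M (row_mx c^T (- dot c x)%:M).
  have [u [t zE]] : exists u : 'cV[R]_m, exists t, z = col_mx u t%:M.
    by exists (usubmx z), (dsubmx z 0 0); rewrite -mx11_scalar vsubmxK.
  have Au i : (A *m u) i 0 <= t * w i 0.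
    have := hz (lshift _ i).
    rewrite zE mul_col_mx col_mxEu mul_row_col mul_mx_scalar !mxE.
    by rewrite mulrN subr_le0.
  have u0 : le_cv 0 u.
    move=> i; have := hz (rshift _ (lshift _ i)).
    rewrite zE mul_col_mx col_mxEd mulNmx mul1mx mxE col_mxEu [leRHS]mxE oppr_le0.
    by move=> ui; rewrite [leLHS]mxE.
  have t0 : 0 <= t.
    have := hz (rshift _ (rshift _ 0)).
    by rewrite zE mul_col_mx col_mxEd mulNmx mul1mx mxE col_mxEd !mxE eqxx oppr_le0.
  have cuE : (row_mx c^T (- dot c x)%:M *m z) 0 0 = dot c u - dot c x * t.
    by rewrite zE mul_row_col mul_mx_scalar mxE /dot [in X in _ + X]mxE !mxE
               eqxx !mulr1n mulrN mulrC.
  rewrite cuE subr_le0.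
  move: t0; rewrite le_eqVlt => /predU1P[t0|t_gt0].
    (* At t = 0, u is a recession direction, and x + u is again feasible. *)
    rewrite -t0 mulr0.
    have := xmax (x + u).
    rewrite (_ : dot c (x + u) = dot c x + dot c u); last first.
      by rewrite /dot mulmxDr mxE.
    rewrite gerDl; apply; split=> i.
      by rewrite [X in _ <= X]mxE !mxE addr_ge0 //;
        [have := x0 i | have := u0 i]; rewrite mxE.
    rewrite mulmxDr mxE -[leRHS]addr0 lerD ?Axw //.
    by rewrite (le_trans (Au i)) // -t0 mul0r.
  have := xmax (t^-1 *: u).
  rewrite (_ : dot c (t^-1 *: u) = t^-1 * dot c u); last first.
    by rewrite /dot -scalemxAr mxE.
  rewrite mulrC ler_pdivrMr //; apply; split=> i.
    rewrite !mxE mulr_ge0 ?invr_ge0 ?(ltW t_gt0) //.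
    by have := u0 i; rewrite mxE.
  by rewrite -scalemxAr mxE mulrC ler_pdivrMr // mulrC.
rewrite /M -[l]hsubmxK; set y := lsubmx l; set s := rsubmx l.
rewrite mul_row_col mulmxN mulmx1 mul_mx_row.
rewrite -[s]hsubmxK opp_row_mx add_row_mx => /eq_row_mx[cE vE].
(* The multipliers s are slacks: m of them for the constraints A^T y >= c, and
   one for w^T y <= c^T x. *)
have y0 : le_cv 0 y^T by move=> i; rewrite !mxE l0.
have cy : le_cv c (A^T *m y^T).
  move=> i; rewrite -trmx_mul -[c]trmxK cE mxE [leRHS]mxE mxE gerDl.
  by rewrite !mxE oppr_le0 l0.
exists y^T; split=> //; apply/eqP; rewrite eq_le; apply/andP; split.
  have ywE : dot w y^T = (y *m w) 0 0 by rewrite /dot -trmx_mul mxE.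
  have := congr1 (fun B : 'M_1 => B 0 0) vE.
  rewrite /= mxE eqxx mulr1n mxE mulmxN [X in X + _]mxE -ywE => vE'.
  by rewrite -lerN2 vE' gerDl !mxE oppr_le0 l0.
rewrite dotC [dot w _]dotC (le_trans (ler_dot x0 cy)) // dotC dot_trmul.
exact: ler_dot.
Qed.

Lemma game_max (R : realType) (n m : nat) (A : 'M[R]_(n, m))
    (X : set 'cV[R]_m) (g : 'cV[R]_m -> R) w x :
  feasible A X w x -> (forall z, feasible A X w z -> g z <= g x) ->
  game A X g w = g x.
Proof.
move=> Xx xmax; apply/eqP; rewrite eq_le; apply/andP; split.
  by apply: ge_sup => [|_ [z Xz <-]]; [exists (g x), x | exact: xmax].
apply: ub_le_sup; last by exists x.
by exists (g x) => _ [z Xz <-]; exact: xmax.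
Qed.

Lemma lin_extE (R : realType) (m : nat) (f : 'cV[R]_m -> R) x :
  lin_ext f x = dot (\col_j f (unit_cv R j)) x.
Proof. by rewrite dotE; apply: eq_bigr => j _; rewrite mxE. Qed.

Lemma dot_unit (R : realType) (n : nat) (v : 'cV[R]_n) i :
  dot (unit_cv R i) v = v i 0.
Proof. by rewrite /dot /unit_cv trmx_delta -rowE mxE. Qed.

(** Core inequality at the singletons. *)
Lemma core_ge0 (R : realType) (n m : nat) (A : 'M[R]_(n, m))
    (X : set 'cV[R]_m) (g : 'cV[R]_m -> R) (y : 'cV[R]_n) :
  max_attained A X g -> X 0 -> g 0 = 0 -> core (game A X g) y -> le_cv 0 y.
Proof.
move=> gmax X0 g0 [_ hy] i; rewrite mxE -dot_unit.
have e01 : zero_one (unit_cv R i).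
  by move=> k l; rewrite mxE; case: (_ && _); [right | left].
apply: le_trans (hy _ e01); have [x Xx xmax] := gmax _ e01.
rewrite (game_max Xx xmax) -g0; apply: xmax; split=> // k.
by rewrite mulmx0 !mxE ler0n.
Qed.

(** Core inequality at the columns of A, which are 0/1 vectors. *)
Lemma core_dual_feasible (R : realType) (n m : nat) (A : 'M[R]_(n, m))
    (X : set 'cV[R]_m) (g : 'cV[R]_m -> R) (y : 'cV[R]_n) :
  zero_one A -> max_attained A X g -> (forall j, X (unit_cv R j)) ->
  core (game A X g) y -> le_cv (\col_j g (unit_cv R j)) (A^T *m y).
Proof.
move=> A01 gmax Xe [_ hy] j.
have a01 : zero_one (A *m unit_cv R j) by rewrite -colE => k l; rewrite mxE.
have -> : (A^T *m y) j 0 = dot (A *m unit_cv R j) y.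
  by rewrite dotC -dot_trmul dotC dot_unit.
rewrite mxE; apply: le_trans (hy _ a01); have [x Xx xmax] := gmax _ a01.
by rewrite (game_max Xx xmax); apply: xmax; split=> // k.
Qed.

Theorem theorem3 (R : realType) (n m : nat)
  (A : 'M[R]_(n, m)) (X : set 'cV[R]_m) (f : 'cV[R]_m -> R)
  (hA01 : zero_one A)
  (hAcol : forall j : 'I_m, col j A <> 0)
  (hX0 : X 0)
  (hXe : forall j : 'I_m, X (unit_cv R j))
  (hXpos : X `<=` orthant R m)
  (hf0 : f 0 = 0)
  (hfF : forall x : 'cV[R]_m, X x -> f x <= \sum_(j < m) f (unit_cv R j) * x j 0)
  (hmax_X : max_attained A X f)
  (hmax_Xbar : max_attained A (agree_set X f) (lin_ext f))
  (hmax_orthant : max_attained A (orthant R m) (lin_ext f)) :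
  core (game A X f) !=set0 <->
  game A (agree_set X f) (lin_ext f) (ones R n) =
  game A (orthant R m) (lin_ext f) (ones R n).
Proof.
have o01 : zero_one (ones R n) by move=> i j; rewrite mxE; right.
have [xX [Xx Ax] xXmax] := hmax_X _ o01.
have [xb xbF xbmax] := hmax_Xbar _ o01.
have [xo xoF xomax] := hmax_orthant _ o01.
rewrite (game_max xbF xbmax) (game_max xoF xomax).
have vbo : lin_ext f xb <= lin_ext f xo.
  by apply: xomax; case: xbF => -[Xxb _] Axb; split=> //; exact: hXpos.
split=> [[y ycore]|vE].
  have y0 := core_ge0 hmax_X hX0 hf0 ycore.
  have cy := core_dual_feasible hA01 hmax_X hXe ycore.
  have xoy : lin_ext f xo <= f xX.
    case: ycore => + _; rewrite (game_max (conj Xx Ax) xXmax) => <-.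
    rewrite lin_extE dotC [leRHS]dotC; case: xoF => xo0 Axo.
    by rewrite (le_trans (ler_dot xo0 cy)) // dotC dot_trmul ler_dot.
  have xXo : lin_ext f xX <= lin_ext f xo by apply: xomax; split=> //; exact: hXpos.
  have fxX : f xX = lin_ext f xX.
    by apply/eqP; rewrite eq_le hfF //= (le_trans xXo).
  apply/eqP; rewrite eq_le vbo /= (le_trans xoy) // fxX.
  by apply: xbmax.
have [y [y0 cy yv]] : exists y, [/\ le_cv 0 y,
    le_cv (\col_j f (unit_cv R j)) (A^T *m y) & dot (ones R n) y = lin_ext f xo].
  rewrite lin_extE; apply: lp_strong_duality => // z /xomax.
  by rewrite !lin_extE.
exists y; split=> [|a a01].
  rewrite (game_max (conj Xx Ax) xXmax) yv; apply/eqP; rewrite eq_le.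
  apply/andP; split.
    rewrite -vE; case: xbF => -[Xxb <-] Axb; exact: xXmax.
  by rewrite (le_trans (hfF _ Xx)) // xomax //; split=> //; exact: hXpos.
have [x [Xxa Axa] xmax] := hmax_X _ a01.
rewrite (game_max (conj Xxa Axa) xmax) (le_trans (hfF _ Xxa)) //.
rewrite -[leLHS]/(lin_ext f x) lin_extE dotC (le_trans (ler_dot (hXpos _ Xxa) cy)) //.
by rewrite dotC dot_trmul dotC [leRHS]dotC [leLHS]dotC ler_dot.
Qed.
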